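(* For all integers $n\geq 0$, we have $B(27n+16)\equiv 0\pmod{3}$.
   Context: For $m\in\mathbb{N}$ and $|q|<1$ let $f_m:=\prod_{n\geq 1}(1-q^{mn})$. $B(n)$ denotes the number of partition triples $\pi=(\pi_1,\pi_2,\pi_3)$ of $n$ (the sum of all parts of $\pi_1,\pi_2,\pi_3$ is $n$; empty partitions are allowed) such that $\pi_1$ and $\pi_2$ each consist of distinct odd parts and $\pi_3$ consists of parts divisible by $4$. Equivalently, $\sum_{n=0}^\infty B(n)q^n=\dfrac{f_2^4}{f_1^2f_4^3}$. *)

(* Defs.v *)
From mathcomp Require Import all_boot.

Set Implicit Arguments.
Unset Strict Implicit.
Unset Printing Implicit Defensive.

(* A partition is the weakly decreasing list of its (positive) parts;
   the empty list is the partition of 0. *)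
Definition is_partition (s : seq nat) : bool := sorted geq s && all (ltn 0) s.

Definition partition_triple (n : nat) (p1 p2 p3 : seq nat) : bool :=
  [&& [&& is_partition p1, uniq p1 & all odd p1],
      [&& is_partition p2, uniq p2 & all odd p2],
      is_partition p3 && all (dvdn 4) p3
    & sumn p1 + sumn p2 + sumn p3 == n].

(* A partition of some m <= n has at most n parts, each at most n, so the
   lists below range over all partitions that can occur in a triple of n;
   see [triple_codeP]. *)
Definition part_code (n : nat) : finType := {bseq n of 'I_n.+1}.

Definition parts (n : nat) (c : part_code n) : seq nat :=
  [seq val i | i <- (c : {bseq n of 'I_n.+1})].

Definition B (n : nat) : nat :=
  #|[set c : part_code n * part_code n * part_code n |
      partition_triple n (parts c.1.1) (parts c.1.2) (parts c.2)]|.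

Lemma parts_inj n : injective (@parts n).
Proof. by move=> c d /(inj_map val_inj) /val_inj. Qed.

Lemma part_codeP n s :
  is_partition s -> sumn s <= n -> exists c : part_code n, parts c = s.
Proof.
move=> /andP[_ pos_s] le_sn.
have sz_s : size s <= sumn s.
  elim: s pos_s {le_sn} => //= x s IHs /andP[x_gt0 /IHs].
  by rewrite -add1n; apply: leq_add.
have lt_s : all (fun x => x < n.+1) s.
  apply/allP => x x_s; rewrite ltnS; apply: leq_trans le_sn.
  elim: s x_s {pos_s sz_s} => //= y s IHs; rewrite inE.
  case/orP=> [/eqP-> | /IHs le_x]; first exact: leq_addr.
  exact: leq_trans le_x (leq_addl _ _).
have sz_c : size [seq (inord i : 'I_n.+1) | i <- s] <= n.
  by rewrite size_map (leq_trans sz_s).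
exists (Bseq sz_c).
rewrite /parts /= -map_comp -[RHS]map_id; apply/eq_in_map => x /(allP lt_s).
exact: inordK.
Qed.

(* [parts] is a bijection from the codes counted by [B n] onto the partition
   triples of n. *)
Lemma triple_codeP n p1 p2 p3 :
  partition_triple n p1 p2 p3 ->
  exists! c : part_code n * part_code n * part_code n,
    (parts c.1.1, parts c.1.2, parts c.2) = (p1, p2, p3).
Proof.
case/and4P=> /and3P[P1 _ _] /and3P[P2 _ _] /andP[P3 _] /eqP def_n.
have [|c1 E1] := part_codeP (n := n) P1.
  by rewrite -def_n -addnA leq_addr.
have [|c2 E2] := part_codeP (n := n) P2.
  by rewrite -def_n addnAC leq_addl.
have [|c3 E3] := part_codeP (n := n) P3; first by rewrite -def_n leq_addl.
exists (c1, c2, c3); split=> [|[[d1 d2] d3]] /=; first by rewrite E1 E2 E3.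
by case; rewrite -E1 -E2 -E3 => /parts_inj-> /parts_inj-> /parts_inj->.
Qed.

(* Main.v *)
From HB Require Import structures.
Require Import Defs.
From mathcomp Require Import all_boot all_order all_algebra.
From mathcomp Require Import ring zify boolp.

(** Let F be the power series whose coefficients are the B(n), and let
      phi(-q) = sum_(a in Z) (-1)^a q^(a^2),   psi(q) = sum_(j in Z) q^(2j^2 - j)
    be Gauss's theta functions. The proof only manipulates these, over the field with
    three elements.

    The Jacobi triple product ([jacobi_triple_product], obtained as a limit of a
    polynomial identity for Gaussian binomials) expresses the theta functions as
    infinite products. Comparing with Euler's product for F ([Bseries_qprod]) gives
      F psi(-q)^3 = phi(-q) psi(q) = psi(-q) phi(-q^2)
    ([Bseries_theta], [phi_psi]). In characteristic 3 the cube of a series s(q) is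
    s(q^3) ([F3_frobenius]), and a factor in q^3 does not interfere with the
    extraction of the exponents in a residue class modulo 3.

    Extracting the exponents 1 mod 3 requires the main lemma [trisect1_phi_psi]:
    in T(q) = phi(-q) psi(q) these exponents contribute - q T(q^9). Indeed the
    coefficient of q^n in T counts, with signs, the elements
    z = (4j - 1) + 2a sqrt(-2) of norm 8n + 1. If n = 1 mod 3, then 3 divides the
    norm, so z is divisible by w = 1 + sqrt(-2) or by its conjugate. The z divisible
    by w cancel in pairs, because the reflection z -> conj z * w / conj w reverses the
    sign ([sum_diag]); so do those divisible by conj w. What remains, by
    inclusion-exclusion, is minus the sum over the multiples of 3. Hence, with
    F1 = sum B(3n+1) q^n,
      F1 psi(-q) = - T(q^3),   and so   F1 psi(-q^3) = - T(q^3) psi(-q)^2.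
    In psi(-q) the exponents 1 mod 3 contribute - q psi(-q^9), and none is 2 mod 3.
    Extracting the exponents 2 mod 3 of the last identity therefore gives, for
    F2 = sum B(9n+7) q^n,
      F2 psi(-q) = - T(q) psi(-q^3)^2,   that is   F2 = - phi(-q^2) psi(-q^3)^2.
    Since 2a^2 is never 1 mod 3, no exponent 1 mod 3 occurs in F2, and the
    coefficient of q^(3n+1) in F2 is B(27n+16). *)

Set Implicit Arguments.
Unset Strict Implicit.
Unset Printing Implicit Defensive.

Import Order.TTheory GRing.Theory Num.Theory.
Local Open Scope ring_scope.

(** * The ring of formal power series *)

Record series (R : Type) := Series {coef : nat -> R}.

Lemma coef_inj (R : Type) : injective (@coef R).
Proof. by case=> f [g] /= ->. Qed.

Lemma seriesP (R : Type) (s t : series R) : coef s =1 coef t -> s = t.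
Proof. by move=> /funext/coef_inj. Qed.

HB.instance Definition _ (R : Type) := gen_eqMixin (series R).
HB.instance Definition _ (R : Type) := gen_choiceMixin (series R).

Section SeriesRing.
Variable R : comNzRingType.
Implicit Types s t u : series R.

Definition sadd s t := Series (fun n => coef s n + coef t n).
Definition sopp s := Series (fun n => - coef s n).
Definition smul s t :=
  Series (fun n => \sum_(i < n.+1) coef s i * coef t (n - i)%N).
Definition sone : series R := Series (fun n => (n == 0%N)%:R).

Lemma saddA : associative sadd.
Proof. by move=> s t u; apply: seriesP => n /=; rewrite addrA. Qed.
Lemma saddC : commutative sadd.
Proof. by move=> s t; apply: seriesP => n /=; rewrite addrC. Qed.
Lemma sadd0 : left_id (Series (fun=> 0)) sadd.
Proof. by move=> s; apply: seriesP => n /=; rewrite add0r. Qed.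
Lemma saddN : left_inverse (Series (fun=> 0)) sopp sadd.
Proof. by move=> s; apply: seriesP => n /=; rewrite addNr. Qed.

HB.instance Definition _ :=
  GRing.isZmodule.Build (series R) saddA saddC sadd0 saddN.

(** The Cauchy product agrees with the product of truncations in [{poly R}], from
    which it inherits commutativity and associativity. *)
Definition trunc N s : {poly R} := \poly_(i < N) coef s i.

Lemma coef_trunc N s i : (i < N)%N -> (trunc N s)`_i = coef s i.
Proof. by rewrite coef_poly => ->. Qed.

Lemma smul_trunc N s t n : (n < N)%N ->
  coef (smul s t) n = (trunc N s * trunc N t)`_n.
Proof.
move=> ltnN; rewrite coefM; apply: eq_bigr => i _.
by rewrite !coef_trunc //; have := ltn_ord i; lia.
Qed.

Lemma smulC : commutative smul.
Proof.
by move=> s t; apply: seriesP => n; rewrite !(@smul_trunc n.+1) // mulrC.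
Qed.

Lemma smulA : associative smul.
Proof.
have smulA_trunc s t u n :
    coef (smul s (smul t u)) n =
    (trunc n.+1 s * (trunc n.+1 t * trunc n.+1 u))`_n.
  rewrite coefM; apply: eq_bigr => i _.
  by rewrite coef_trunc ?ltn_ord // (@smul_trunc n.+1) // ltnS leq_subr.
move=> s t u; apply: seriesP => n.
by rewrite (smulC (smul s t)) !smulA_trunc mulrA mulrC.
Qed.

Lemma smul1 : left_id sone smul.
Proof.
move=> s; apply: seriesP => n /=.
by rewrite big_ord_recl /= mul1r subn0 big1 ?addr0 // => i _; rewrite mul0r.
Qed.

Lemma smulDl : left_distributive smul sadd.
Proof.
move=> s t u; apply: seriesP => n /=; rewrite -big_split /=.
by apply: eq_bigr => i _; rewrite mulrDl.
Qed.

Lemma sone_neq0 : sone != 0.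
Proof. by apply/eqP => /(congr1 (fun s => coef s 0))/eqP; rewrite oner_eq0. Qed.

HB.instance Definition _ :=
  GRing.Zmodule_isComNzRing.Build (series R) smulA smulC smul1 smulDl sone_neq0.

Lemma coefsD s t n : coef (s + t) n = coef s n + coef t n. Proof. by []. Qed.
Lemma coefsN s n : coef (- s) n = - coef s n. Proof. by []. Qed.
Lemma coefs1 n : coef (1 : series R) n = (n == 0%N)%:R. Proof. by []. Qed.
Lemma coefsM s t n :
  coef (s * t) n = \sum_(i < n.+1) coef s i * coef t (n - i)%N.
Proof. by []. Qed.

Lemma coefs_sum I (r : seq I) (P : pred I) (F : I -> series R) n :
  coef (\sum_(i <- r | P i) F i) n = \sum_(i <- r | P i) coef (F i) n.
Proof. by elim/big_rec2: _ => // i _ s _ <-. Qed.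

Definition monom c n : series R := Series (fun i => if i == n then c else 0).

Lemma coef_monomM c m s n :
  coef (monom c m * s) n = if (n < m)%N then 0 else c * coef s (n - m)%N.
Proof.
rewrite coefsM; case: ltnP => [ltnm | lemn].
  rewrite big1 // => i _ /=; have ltin := ltn_ord i.
  by rewrite (_ : _ == m = false) ?mul0r //; lia.
rewrite (bigD1 (Ordinal (lemn : m < n.+1)%N)) //= eqxx big1 ?addr0 // => i.
by rewrite -val_eqE /= => /negPf->; rewrite mul0r.
Qed.

Lemma monomM c d m n : monom c m * monom d n = monom (c * d) (m + n)%N.
Proof.
apply: seriesP => i; rewrite coef_monomM /=; case: ltnP => [ltim|leim].
  by rewrite ifF //; lia.
by rewrite [LHS]fun_if mulr0; congr (if _ then _ else _); lia.
Qed.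

Lemma monom0 : monom 1 0 = 1. Proof. by apply: seriesP => i /=; case: (i == _). Qed.

Lemma monomX c m n : monom c m ^+ n = monom (c ^+ n) (m * n)%N.
Proof.
elim: n => [|n IHn]; first by rewrite muln0 !expr0 monom0.
by rewrite !exprS IHn monomM mulnS.
Qed.

Lemma monomN c m : monom (- c) m = - monom c m.
Proof. by apply: seriesP => i /=; case: eqP; rewrite ?oppr0. Qed.

(** Congruence modulo q^N. Identities between infinite sums and products are
    proved by checking them in this sense for every N. *)
Definition eqX N s t := forall i, (i < N)%N -> coef s i = coef t i.

Lemma eqX_refl N s : eqX N s s. Proof. by []. Qed.
Lemma eqX_sym N s t : eqX N s t -> eqX N t s.
Proof. by move=> e i /e. Qed.
Lemma eqX_trans N t s u : eqX N s t -> eqX N t u -> eqX N s u.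
Proof. by move=> e f i ltiN; rewrite e ?f. Qed.
Lemma eqXW M N s t : (M <= N)%N -> eqX N s t -> eqX M s t.
Proof. by move=> leMN e i ltiM; apply/e/(leq_trans ltiM). Qed.
Lemma eqXD N s s' t t' : eqX N s s' -> eqX N t t' -> eqX N (s + t) (s' + t').
Proof. by move=> e f i ltiN /=; rewrite e ?f. Qed.
Lemma eqXM N s s' t t' : eqX N s s' -> eqX N t t' -> eqX N (s * t) (s' * t').
Proof.
move=> e f i ltiN; rewrite !coefsM; apply: eq_bigr => j _.
by rewrite e ?f //; have := ltn_ord j; lia.
Qed.
Lemma eqX_sum N I (r : seq I) (F G : I -> series R) :
  (forall i, eqX N (F i) (G i)) -> eqX N (\sum_(i <- r) F i) (\sum_(i <- r) G i).
Proof. by move=> e; elim/big_rec2: _ => // i s t _; apply: eqXD. Qed.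
Lemma eqX_prod1 N I (r : seq I) (F : I -> series R) :
  (forall i, eqX N (F i) 1) -> eqX N (\prod_(i <- r) F i) 1.
Proof.
move=> e; elim/big_rec: _ => // i s _ es.
by rewrite -[X in eqX _ _ X]mulr1; apply: eqXM.
Qed.
Lemma eqXMr N s t u : eqX N s t -> eqX N (s * u) (t * u).
Proof. by move=> e; apply: eqXM. Qed.
Lemma eqXP s t : (forall N, eqX N s t) -> s = t.
Proof. by move=> e; apply: seriesP => i; apply: (e i.+1). Qed.
Lemma eqX0M M N s t : eqX M s 0 -> eqX N t 0 -> eqX (M + N)%N (s * t) 0.
Proof.
move=> e f i ltiN; rewrite coefsM big1 // => j _; case: (ltnP j M) => [ltjM|leMj].
  by rewrite e ?mul0r.
by rewrite f ?mulr0 //; have := ltn_ord j; lia.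
Qed.
Lemma eqX0X M n s : eqX M s 0 -> eqX (M * n)%N (s ^+ n) 0.
Proof.
move=> e; elim: n => [|n IHn]; first by rewrite muln0.
by rewrite exprS mulnS; apply: eqX0M.
Qed.
Lemma eqX_subr0 N s t : eqX N (s - t) 0 <-> eqX N s t.
Proof.
split=> e i ltiN; last by rewrite coefsD coefsN e ?subrr.
by apply/eqP; rewrite -subr_eq0; apply/eqP/(e i ltiN).
Qed.

Lemma eqX1D n (s : series R) : eqX n s 0 -> eqX n (1 + s) 1.
Proof. by move=> e; rewrite -[X in eqX _ _ X]addr0; apply: eqXD. Qed.

Lemma eqX1B n (s : series R) : eqX n s 0 -> eqX n (1 - s) 1.
Proof. by move=> e; apply: eqX1D => i ltin; rewrite coefsN e // oppr0. Qed.

(** A series with constant term 1 is invertible. *)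
Lemma eqX_cancel N s t u : coef u 0 = 1 -> eqX N (s * u) (t * u) -> eqX N s t.
Proof.
move=> u1 e; apply/eqX_subr0; have {}e: eqX N ((s - t) * u) 0.
  by rewrite mulrBl; apply/eqX_subr0.
move: (s - t) e => d e.
elim/ltn_ind=> i IHi ltiN; move: (e i ltiN).
rewrite coefsM big_ord_recr /= subnn u1 mulr1 big1 ?add0r // => j _.
by rewrite (IHi j) ?mul0r //; have := ltn_ord j; lia.
Qed.

Lemma series_cancel s t u : coef u 0 = 1 -> s * u = t * u -> s = t.
Proof. by move=> u1 e; apply: eqXP => N; apply: (eqX_cancel u1); rewrite e. Qed.

Lemma eqX_monom c n : eqX n (monom c n) 0.
Proof. by move=> i ltin /=; rewrite ifF //; lia. Qed.

(** The k-th factor is 1 modulo q^(k+1), so that the coefficient of q^n is the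
    same in all partial products with more than n factors. *)
Definition prod_cvg (f : nat -> series R) := forall k, eqX k.+1 (f k) 1.
Definition iprod (f : nat -> series R) : series R :=
  Series (fun n => coef (\prod_(k < n.+1) f k) n).

Lemma prod_stable f L N : prod_cvg f -> (L <= N)%N ->
  eqX L (\prod_(k < N) f k) (\prod_(k < L) f k).
Proof.
move=> cvf; elim: N => [|N IHN]; first by rewrite leqn0 => /eqP->.
rewrite leq_eqVlt => /predU1P[-> // | leLN].
rewrite big_ord_recr /= -[X in eqX _ _ X]mulr1.
by apply: eqXM; [apply: IHN | apply: eqXW (cvf N); lia].
Qed.

Lemma iprodP f L N : prod_cvg f -> (L <= N)%N -> eqX L (iprod f) (\prod_(k < N) f k).
Proof.
move=> cvf leLN i ltiL; rewrite [RHS](@prod_stable f i.+1) //.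
exact: leq_trans leLN.
Qed.

Lemma eq_iprod f g : f =1 g -> iprod f = iprod g.
Proof. by move=> /funext->. Qed.

Lemma prod_cvgM f g : prod_cvg f -> prod_cvg g -> prod_cvg (fun k => f k * g k).
Proof. by move=> cf cg k; rewrite -[X in eqX _ _ X]mulr1; apply: eqXM. Qed.

Lemma iprodM f g : prod_cvg f -> prod_cvg g ->
  iprod (fun k => f k * g k) = iprod f * iprod g.
Proof.
move=> cf cg; apply: eqXP => N; apply: eqX_trans (iprodP (prod_cvgM cf cg) (leqnn N)) _.
by rewrite big_split; apply/eqX_sym/eqXM; apply: iprodP.
Qed.

Lemma iprod_parity f : prod_cvg f ->
  iprod f = iprod (fun k => f k.*2) * iprod (fun k => f k.*2.+1).
Proof.
move=> cf.
have ce: prod_cvg (fun k => f k.*2) by move=> k; apply: eqXW (cf _); lia.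
have co: prod_cvg (fun k => f k.*2.+1) by move=> k; apply: eqXW (cf _); lia.
rewrite -iprodM //; apply: eqXP => N.
have leN2: (N <= N.*2)%N by lia.
apply: eqX_trans (iprodP cf leN2) _; apply: eqX_sym.
apply: eqX_trans (iprodP (prod_cvgM ce co) (leqnn N)) _.
suff ->: \prod_(k < N.*2) f k = \prod_(k < N) (f k.*2 * f k.*2.+1) by [].
elim: N {leN2} => [|N IHN]; first by rewrite !big_ord0.
by rewrite doubleS !big_ord_recr /= IHN -mulrA.
Qed.

Lemma coef_prod0 f n : prod_cvg f -> coef (\prod_(k < n) f k) 0 = 1.
Proof.
move=> cf; elim: n => [|n IHn]; first by rewrite big_ord0.
by rewrite big_ord_recr coefsM big_ord1 IHn mul1r cf.
Qed.

Lemma coef_iprod0 f : prod_cvg f -> coef (iprod f) 0 = 1.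
Proof. by move=> cf; apply: coef_prod0. Qed.

End SeriesRing.

Arguments monom {R} c n%_N.
Arguments eqX {R} N%_N s t.

(** * The Jacobi triple product *)

Section GaussBinomial.
Variables (R : comNzRingType) (Q : R).

(** Gaussian binomial coefficients, with q specialised to [Q]. *)
Fixpoint gauss n k : R :=
  match n, k with
  | _, 0 => 1
  | 0, _.+1 => 0
  | n'.+1, k'.+1 => gauss n' k'.+1 + Q ^+ (n' - k') * gauss n' k'
  end.

Lemma gauss0 n : gauss n 0 = 1. Proof. by case: n. Qed.

Lemma gauss_small n k : (n < k)%N -> gauss n k = 0.
Proof.
elim: n k => [|n IHn] [|k] //= ltnk.
by rewrite !IHn ?mulr0 ?addr0 //; lia.
Qed.

(** The q-Pochhammer symbol (Q; Q)_n. *)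
Definition pochh n : R := \prod_(k < n) (1 - Q ^+ k.+1).

(** The quotient formula for Gaussian binomials, without division. *)
Lemma gauss_pochh n k : (k <= n)%N ->
  gauss n k * (pochh k * pochh (n - k)) = pochh n.
Proof.
elim: n k => [|n IHn] [|k] // lekn; rewrite ?gauss0.
- by rewrite /pochh big_ord0 !mulr1.
- by rewrite /pochh big_ord0 subn0 !mul1r.
have pochhS m : pochh m.+1 = pochh m * (1 - Q ^+ m.+1) by rewrite /pochh big_ord_recr.
rewrite /= subSS; have := lekn; rewrite ltnS leq_eqVlt => /predU1P[-> | ltkn].
  rewrite gauss_small // subnn add0r expr0 mul1r pochhS.
  have := IHn n (leqnn n); rewrite subnn => e.
  by rewrite -[in RHS]e; ring.
have := IHn k lekn; have := IHn k.+1 ltkn.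
have -> : (n - k = (n - k.+1).+1)%N by lia.
have -> : pochh n.+1 = pochh n * (1 - Q ^+ (n - k.+1).+1 * Q ^+ k.+1).
  by rewrite pochhS -exprD; congr (_ * (1 - Q ^+ _)); lia.
rewrite !pochhS => e2 e1.
transitivity (pochh n * (1 - Q ^+ (n - k.+1).+1)
              + Q ^+ (n - k.+1).+1 * (1 - Q ^+ k.+1) * pochh n); last first.
  by move: (Q ^+ _) (Q ^+ _) => x y; ring.
by rewrite -{1}e2 -e1; ring.
Qed.

(** The Pascal rule dual to the one in the definition of [gauss]. *)
Lemma gauss_pascal n k : gauss n.+1 k.+1 = gauss n k + Q ^+ k.+1 * gauss n k.+1.
Proof.
elim: n k => [|n IHn] k; first by case: k => [|k] /=; rewrite !mulr0 ?mulr1 addrC.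
have [ltnk | lekn] := ltnP n k.
  rewrite [gauss n.+2 _]/= -/(gauss n.+1 k.+1) -/(gauss n.+1 k).
  rewrite (@gauss_small n.+1 k.+1) ?ltnS // (eqP (ltnk : n.+1 - k == 0)%N).
  by rewrite mulr0 addr0 add0r mul1r.
rewrite [LHS]/= -/(gauss n.+1 k.+1) -/(gauss n.+1 k) {1}IHn.
rewrite [X in _ = _ + _ * X]/=.
case: k lekn => [|k] ltkn; first by rewrite !gauss0 !subn0 expr1 exprS; ring.
rewrite {1}IHn [gauss n.+1 k.+1]/= subSS.
have -> : (n - k = (n - k.+1).+1)%N by lia.
rewrite !exprS; ring.
Qed.

(** If each [t i.+1] is [c * t i] up to the power of Q of the Pascal rule, then one
    more row of Gaussian binomials multiplies the sum by 1 + c: this is how each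
    factor of the triple product appears. *)
Lemma gauss_sumS (t : nat -> R) n c :
    (forall i, (i <= n)%N -> Q ^+ (n - i) * t i.+1 = c * t i) ->
  \sum_(i < n.+2) gauss n.+1 i * t i =
  (1 + c) * \sum_(i < n.+1) gauss n i * t i.
Proof.
move=> tS; rewrite big_ord_recl gauss0 mul1r.
under eq_bigr do rewrite /= /bump add1n mulrDl.
rewrite big_split /= addrA mulrDl mul1r; congr (_ + _).
  rewrite [RHS]big_ord_recl gauss0 mul1r big_ord_recr /=.
  by rewrite gauss_small // mul0r addr0.
rewrite mulr_sumr; apply: eq_bigr => i _.
by rewrite mulrAC (tS _ (ltn_ord i)) mulrAC mulrA.
Qed.

(** The counterpart of [gauss_sumS] for the dual Pascal rule. *)
Lemma gauss_sumSr (t : nat -> R) n c :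
    (forall i, (i <= n)%N -> Q ^+ i * t i = c * t i.+1) ->
  \sum_(i < n.+2) gauss n.+1 i * t i =
  (1 + c) * \sum_(i < n.+1) gauss n i * t i.+1.
Proof.
move=> tS; rewrite big_ord_recl gauss0 mul1r.
under eq_bigr do rewrite lift0 gauss_pascal mulrDl.
rewrite big_split addrCA mulrDl mul1r; congr (_ + _).
transitivity (\sum_(i < n.+1) Q ^+ i * gauss n i * t i).
  rewrite [RHS]big_ord_recl gauss0 !mul1r big_ord_recr /=.
  by rewrite gauss_small // mulr0 mul0r addr0.
rewrite mulr_sumr; apply: eq_bigr => i _.
by rewrite mulrAC (tS _ (ltn_ord i)) mulrAC mulrA.
Qed.

End GaussBinomial.

(** Triangular numbers j(j+1)/2 for j in Z; [tri (- j)] is j(j-1)/2. *)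
Definition tri (j : int) : nat := (`|(j * (j + 1))%R| %/ 2)%N.

Lemma triE j : (tri j)%:Z * 2 = j * (j + 1).
Proof.
rewrite /tri; have : (2 %| `|(j * (j + 1))%R|)%N.
  by rewrite dvdn2 abszM oddM; lia.
move=> /divnK e; rewrite -[2]/(2%:Z) -PoszM e gez0_abs //.
by have [j0|j0] := leP 0 j; [apply: mulr_ge0 | apply: mulr_le0]; lia.
Qed.

Lemma triD1 j : (tri (j + 1))%:Z = (tri j)%:Z + j + 1.
Proof. by have := triE (j + 1); have := triE j; lia. Qed.

Lemma tri_sum j : (tri j + tri (- j) = `|j| ^ 2)%N.
Proof.
have : (`|j| ^ 2)%:Z = j * j by rewrite -abszX gez0_abs ?sqr_ge0 // expr2.
by have := triE j; have := triE (- j); lia. Qed.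

(** The general term of Ramanujan's theta function f(a, b). *)
Definition thterm (R : comNzRingType) (a b : R) (j : int) : R :=
  a ^+ tri j * b ^+ tri (- j).

(** Passing from j to j+1 multiplies [thterm a b j] by a(ab)^j, so that the factors
    1 + a(ab)^m and 1 + b(ab)^n can be absorbed one at a time by the two Pascal
    rules. Letting m and n grow gives the triple product. *)
Lemma jtp_finite (R : comNzRingType) (a b : R) m n :
  \sum_(i < (n + m).+1) gauss (a * b) (n + m) i * thterm a b (i%:Z - n%:Z) =
  \prod_(k < m) (1 + a * (a * b) ^+ k) * \prod_(k < n) (1 + b * (a * b) ^+ k).
Proof.
elim: m => [|m IHm]; last first.
  rewrite addnS (@gauss_sumS _ _ (fun i => thterm a b (i%:Z - n%:Z)) _
    (a * (a * b) ^+ m)).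
    by rewrite IHm big_ord_recr /= !mulrA [(1 + _) * _]mulrC.
  move=> i lei; rewrite /thterm.
  have := triD1 (i%:Z - n%:Z); have := triD1 (- (i.+1%:Z - n%:Z)).
  have -> : i%:Z - n%:Z + 1 = i.+1%:Z - n%:Z by lia.
  have -> : - (i.+1%:Z - n%:Z) + 1 = - (i%:Z - n%:Z) by lia.
  move: (tri _) (tri _) (tri _) (tri _) => x y z w e1 e2.
  rewrite !exprMn !mulrA [_ * b ^+ _ * a ^+ _]mulrAC -!exprS -!exprD.
  rewrite [a ^+ _ * b ^+ m * a ^+ _]mulrAC -!exprD -!mulrA -!exprD.
  by congr (a ^+ _ * b ^+ _); lia.
rewrite big_ord0 mul1r addn0.
elim: n => [|n IHn].
  by rewrite big_ord1 big_ord0 mul1r /thterm subrr oppr0 mulr1.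
rewrite (@gauss_sumSr _ _ (fun i => thterm a b (i%:Z - n.+1%:Z)) _
  (b * (a * b) ^+ n)).
  rewrite [RHS]big_ord_recr [RHS]mulrC -IHn; congr (_ * _).
  by apply: eq_bigr => i _; congr (_ * thterm _ _ _); lia.
move=> i lei; rewrite /thterm.
have := triD1 (i%:Z - n.+1%:Z); have := triD1 (- (i.+1%:Z - n.+1%:Z)).
have -> : i%:Z - n.+1%:Z + 1 = i.+1%:Z - n.+1%:Z by lia.
have -> : - (i.+1%:Z - n.+1%:Z) + 1 = - (i%:Z - n.+1%:Z) by lia.
move: (tri _) (tri _) (tri _) (tri _) => x y z w e1 e2.
rewrite !exprMn [b * _]mulrCA -exprS !mulrA [_ * b ^+ _ * a ^+ _]mulrAC.
rewrite [a ^+ n * b ^+ _ * a ^+ _]mulrAC -!exprD -!mulrA -!exprD.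
by congr (a ^+ _ * b ^+ _); lia.
Qed.

Definition zball n : seq int := [seq i%:Z - n%:Z | i <- iota 0 n.*2.+1].

Lemma mem_zball n j : (j \in zball n) = (`|j| <= n)%N.
Proof.
apply/mapP/idP => [[i] | lejn].
  by rewrite mem_iota => lei ->; lia.
by exists `|(j + n%:Z)%R|%N; rewrite ?mem_iota; lia.
Qed.

Lemma uniq_zball n : uniq (zball n).
Proof. by rewrite map_inj_uniq ?iota_uniq // => i k; lia. Qed.

Lemma sum_zball (V : zmodType) n (F : int -> V) :
  \sum_(j <- zball n) F j = \sum_(i < n.*2.+1) F (i%:Z - n%:Z).
Proof. by rewrite big_map -[n.*2.+1 in LHS]subn0 -/(index_iota 0 _) big_mkord. Qed.

Section BilateralSums.
Variable R : comNzRingType.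

(** As the j-th term is 0 modulo q^|j|, the coefficient of q^n only involves the
    terms with |j| <= n. *)
Definition bsum_cvg (t : int -> series R) := forall j, eqX `|j|%N (t j) 0.
Definition bsum (t : int -> series R) : series R :=
  Series (fun n => coef (\sum_(j <- zball n) t j) n).

Lemma coef_sum_zball t n M : bsum_cvg t -> (n <= M)%N ->
  coef (\sum_(j <- zball M) t j) n = coef (bsum t) n.
Proof.
move=> cvt lenM; rewrite /= !coefs_sum.
rewrite (bigID (fun j => j \in zball n)) /= [X in _ + X]big1_seq ?addr0; last first.
  by move=> j /andP[]; rewrite !mem_zball -ltnNge => ltnj _; apply: cvt.
rewrite -big_filter; apply/perm_big/uniq_perm; rewrite ?filter_uniq ?uniq_zball //.
by move=> j; rewrite mem_filter !mem_zball; lia.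
Qed.

Lemma bsumP t N : bsum_cvg t -> eqX N (bsum t) (\sum_(j <- zball N) t j).
Proof. by move=> cvt i ltiN; rewrite (coef_sum_zball cvt) // ltnW. Qed.

Variables a b : series R.
Hypotheses (a0 : eqX 1 a 0) (b0 : eqX 1 b 0).

Lemma bsum_cvg_thterm : bsum_cvg (thterm a b).
Proof.
move=> j; have := eqX0M (eqX0X (n := tri j) a0) (eqX0X (n := tri (- j)) b0).
by rewrite !mul1n tri_sum; apply: eqXW; case: `|j|%N => // n; rewrite leq_pmulr.
Qed.

Lemma eqX_geom c k : eqX 1 c 0 -> eqX k.+1 (c * (a * b) ^+ k) 0.
Proof.
by move=> c0; have := eqX0M c0 (eqX0X (n := k) (eqX0M a0 b0)); apply: eqXW; lia.
Qed.

Lemma prod_cvg_geom c : eqX 1 c 0 -> prod_cvg (fun k => 1 + c * (a * b) ^+ k).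
Proof. by move=> c0 k; apply/eqX1D/eqX_geom. Qed.

Lemma prod_cvg_euler : prod_cvg (fun k => 1 - (a * b) ^+ k.+1).
Proof.
by move=> k; apply/eqX1B; have := eqX0X (n := k.+1) (eqX0M a0 b0); apply: eqXW; lia.
Qed.

(** The binomial n+j out of 2n times (Q; Q)_n tends to 1: in the quotient formula
    all the Pochhammer symbols agree modulo q^(n - |j|). *)
Lemma eqX_gauss n j : (`|j| <= n)%N ->
  eqX (n - `|j|)%N
    (gauss (a * b) (n + n) `|(n%:Z + j)%R|%N * \prod_(k < n) (1 - (a * b) ^+ k.+1)) 1.
Proof.
move=> lejn; set d := (n - _)%N.
have e k l : (d <= k)%N -> (d <= l)%N -> eqX d (pochh (a * b) k) (pochh (a * b) l).
  move=> ledk ledl; apply: eqX_trans (prod_stable prod_cvg_euler ledk) _.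
  exact/eqX_sym/(prod_stable prod_cvg_euler ledl).
apply: (@eqX_cancel _ _ _ _ (pochh (a * b) n)).
  exact: coef_prod0 prod_cvg_euler.
rewrite mul1r -mulrA.
have := @gauss_pochh _ (a * b) (n + n) `|(n%:Z + j)%R|%N.
move=> gP; apply: eqX_trans (_ : eqX d _ (pochh (a * b) (n + n))) _.
  by rewrite -gP; [apply: eqXM => //; apply: eqXM; apply: e | ]; lia.
by apply: e; lia.
Qed.

(** The limit of [jtp_finite]. Modulo q^N it is enough that the central binomials
    are 1 modulo q^(N - |j|), because the j-th term is itself 0 modulo q^|j|. *)
Theorem jacobi_triple_product :
  bsum (thterm a b) =
  iprod (fun k => (1 + a * (a * b) ^+ k) * (1 + b * (a * b) ^+ k) *
                  (1 - (a * b) ^+ k.+1)).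
Proof.
have cv : prod_cvg (fun k => (1 + a * (a * b) ^+ k) * (1 + b * (a * b) ^+ k) *
                  (1 - (a * b) ^+ k.+1)).
  by do 2?apply: prod_cvgM; [exact: prod_cvg_geom.. | exact: prod_cvg_euler].
apply: eqXP => N; apply: eqX_trans (bsumP bsum_cvg_thterm) _; apply: eqX_sym.
apply: eqX_trans (iprodP cv (leqnn N)) _.
rewrite !big_split /= -jtp_finite mulr_suml sum_zball -addnn.
apply: eqX_sum => i; set j := i%:Z - N%:Z.
have lejN : (`|j| <= N)%N by have := ltn_ord i; lia.
have -> : val i = `|(N%:Z + j)%R|%N by rewrite /=; lia.
(* The difference is (binomial - 1) * term, of order (N - |j|) + |j|. *)
rewrite mulrAC; apply/eqX_subr0; rewrite -[X in _ - X]mul1r -mulrBl.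
rewrite -(subnK lejN); apply: eqX0M; last exact: bsum_cvg_thterm.
by apply/eqX_subr0; rewrite subnK //; apply: eqX_gauss.
Qed.

End BilateralSums.

(** * Theta series and their product expansions *)

Section Theta.
Variable R : comNzRingType.
Implicit Types (w : int -> R) (e : int -> nat).

(** This makes the sets [fiber e n] and [lattice e e' n] below contain every
    solution, although they are enumerated inside a box. *)
Definition grow e := forall j, (`|j| <= e j)%N.

Definition theta w e : series R := bsum (fun j => monom (w j) (e j)).

Lemma bsum_cvg_theta w e : grow e -> bsum_cvg (fun j => monom (w j) (e j)).
Proof. by move=> ge j; exact: eqXW (ge j) (@eqX_monom _ _ _). Qed.

Definition fiber e n : seq int := [seq j <- zball n | e j == n].

Lemma coef_theta w e n : coef (theta w e) n = \sum_(j <- fiber e n) w j.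
Proof.
rewrite /= coefs_sum big_filter [RHS]big_mkcond /=.
by apply: eq_bigr => j _ /=; rewrite eq_sym.
Qed.

Definition lattice e e' n : seq (int * int) :=
  [seq p <- [seq (j, k) | j <- zball n, k <- zball n] | (e p.1 + e' p.2)%N == n].

Lemma coef_thetaM w w' e e' n : grow e -> grow e' ->
  coef (theta w e * theta w' e') n = \sum_(p <- lattice e e' n) w p.1 * w' p.2.
Proof.
move=> ge ge'.
have le (v : int -> R) f (gf : grow f) :
    eqX n.+1 (theta v f) (\sum_(j <- zball n) monom (v j) (f j)).
  by move=> i lein; rewrite (coef_sum_zball (bsum_cvg_theta v gf)).
rewrite (eqXM (le w e ge) (le w' e' ge')) //.
rewrite mulr_suml coefs_sum [RHS]big_filter [RHS]big_mkcond.
rewrite [RHS]big_allpairs_dep; apply: eq_bigr => j _.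
rewrite mulr_sumr coefs_sum; apply: eq_bigr => k _.
by rewrite monomM /= eq_sym.
Qed.

Lemma mem_lattice e e' n p : grow e -> grow e' ->
  (p \in lattice e e' n) = ((e p.1 + e' p.2)%N == n).
Proof.
case: p => j k ge ge'; rewrite mem_filter; apply: andb_idr => /eqP en.
apply/allpairsPdep; exists j, k; rewrite !mem_zball; move: en => /= en; split=> //.
  by have := ge j; lia.
by have := ge' k; lia.
Qed.

Lemma uniq_lattice e e' n : uniq (lattice e e' n).
Proof.
by apply/filter_uniq/allpairs_uniq; rewrite ?uniq_zball // => -[? ?] [? ?].
Qed.

End Theta.

Section ThetaProducts.
Variable R : comNzRingType.

(** The Pochhammer symbol (q^p; q^d) for u = 1, and (- q^p; q^d) for u = 0. *)
Definition qprod u p d : series R :=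
  iprod (fun k => 1 + monom ((-1) ^+ u) (p + d * k)).

Lemma prod_cvg_qprod u p d : (0 < p)%N -> (0 < d)%N ->
  prod_cvg (fun k => 1 + monom ((-1) ^+ u : R) (p + d * k)).
Proof.
move=> p0 d0 k; apply/eqX1D/(eqXW _ (@eqX_monom _ _ _)).
by have := leq_pmull k d0; lia.
Qed.

Lemma coef_qprod0 u p d : (0 < p)%N -> (0 < d)%N -> coef (qprod u p d) 0 = 1.
Proof. by move=> p0 d0; apply/coef_iprod0/prod_cvg_qprod. Qed.

(** Even and odd k in (q^p; q^d). *)
Lemma qprod_split u p d : (0 < p)%N -> (0 < d)%N ->
  qprod u p d = qprod u p (d * 2) * qprod u (p + d) (d * 2).
Proof.
move=> p0 d0; rewrite /qprod iprod_parity; last exact: prod_cvg_qprod.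
by congr (iprod _ * iprod _); apply/funext => k; congr (1 + monom _ _); lia.
Qed.

(** (1 + x)(1 - x) = 1 - x^2 in each factor. *)
Lemma qprod_conj p d : (0 < p)%N -> (0 < d)%N ->
  qprod 0 p d * qprod 1 p d = qprod 1 (p * 2) (d * 2).
Proof.
move=> p0 d0; rewrite -iprodM; do ?exact: prod_cvg_qprod.
apply: eq_iprod => k; rewrite !expr0 expr1 monomN.
rewrite -[monom (-1) _]/(monom (- 1) _) monomN.
have -> : (p * 2 + d * 2 * k = (p + d * k) * 2)%N by lia.
by rewrite -{3}(expr1n R 2) -monomX; ring.
Qed.

Definition sgn (j : int) : R := (-1) ^+ `|j|%N.

(** The triple product at a = (-1)^u q^p and b = (-1)^u q^r. *)
Lemma theta_qprod u p r : (0 < p)%N -> (0 < r)%N ->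
  theta (fun j => sgn j ^+ u) (fun j => p * tri j + r * tri (- j))%N =
  qprod u p (p + r) * qprod u r (p + r) * qprod 1 (p + r) (p + r).
Proof.
move=> p0 r0; set a : series R := monom ((-1) ^+ u) p.
set b : series R := monom ((-1) ^+ u) r.
have pr0 : (0 < p + r)%N by lia.
have [a0 b0] : eqX 1 a 0 /\ eqX 1 b 0 by split; apply: eqXW (@eqX_monom _ _ _).
have ab : a * b = monom 1 (p + r) by rewrite monomM -expr2 sqrr_sign.
transitivity (bsum (thterm a b)).
  congr (bsum _); apply/funext => j; rewrite /thterm !monomX monomM.
  rewrite -exprD tri_sum /sgn -!exprM; congr (monom _ _).
  by rewrite -[LHS]signr_odd -[RHS]signr_odd !oddM; do 2!case: (odd _).
rewrite (jacobi_triple_product a0 b0) -!iprodM;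
  do ?[exact: prod_cvg_qprod | apply: prod_cvgM].
apply: eq_iprod => k; rewrite ab !monomX !expr1n !monomM !mulr1 expr1 monomN.
by rewrite -mulnS.
Qed.

End ThetaProducts.

Section GaussTheta.
Variable R : comNzRingType.

Definition sq d (j : int) : nat := (d * `|j| ^ 2)%N.
(** This is 2j^2 - j, written in the form required by the triple product; as j runs
    through Z it takes every triangular number as value exactly once. *)
Definition hexa (j : int) : nat := (1 * tri j + 3 * tri (- j))%N.

Lemma sqE d j : (sq d j)%:Z = d%:Z * (j * j).
Proof. by rewrite /sq PoszM -abszX gez0_abs ?sqr_ge0 // expr2. Qed.

Lemma hexaE j : (hexa j)%:Z = 2 * (j * j) - j.
Proof. by have := triE j; have := triE (- j); rewrite /hexa; lia. Qed.

Lemma grow_sq d : (0 < d)%N -> grow (sq d).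
Proof.
by move=> d0 j; rewrite /sq; case: d d0 => // d _; case: `|j|%N => // n; nia.
Qed.

Lemma grow_hexa : grow hexa.
Proof. by move=> j; have := hexaE j; nia. Qed.

(** Gauss's theta functions: phi(- q^d), and psi(q) (u = 0) or psi(- q) (u = 1). *)
Definition phi d : series R := theta (@sgn R) (sq d).
Definition psi u : series R := theta (fun j => sgn R j ^+ u) hexa.

Lemma phi_qprod d : (0 < d)%N ->
  phi d = qprod R 1 d (d * 2) ^+ 2 * qprod R 1 (d * 2) (d * 2).
Proof.
move=> d0; rewrite muln2 -addnn -theta_qprod //.
by congr (theta _ _); apply/funext => j; rewrite -mulnDr tri_sum.
Qed.

Lemma psi_qprod u : psi u = qprod R u 1 2 * qprod R 1 4 4.
Proof. by rewrite [psi u]theta_qprod // (@qprod_split _ u 1 2). Qed.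

(** Both sides are (q; q)(q^2; q^2). *)
Lemma phi_psi : phi 1 * psi 0 = psi 1 * phi 2.
Proof.
rewrite !phi_qprod // !psi_qprod.
rewrite (@qprod_split _ 1 2 2) // -[(2 + 2)%N]/4%N.
rewrite -[(1 * 2)%N]/2%N -[(2 * 2)%N]/4%N.
have := @qprod_conj R 1 2 isT isT; rewrite -[(1 * 2)%N]/2%N -[(2 * 2)%N]/4%N => <-.
by ring.
Qed.

End GaussTheta.

(** * Trisection of power series *)

Section Sections.
Variable R : comNzRingType.
Implicit Types s t u : series R.

(** Extraction of the exponents 3n + r, followed by q^3 -> q. *)
Definition trisect r s : series R := Series (fun n => coef s (3 * n + r)%N).
(** The substitution q -> q^3. *)
Definition dilate s : series R :=
  Series (fun n => if (3 %| n)%N then coef s (n %/ 3)%N else 0).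

Lemma trisectD r s t : trisect r (s + t) = trisect r s + trisect r t.
Proof. exact: seriesP. Qed.

Lemma trisectN r s : trisect r (- s) = - trisect r s.
Proof. exact: seriesP. Qed.

Lemma coef_dilate s n : coef (dilate s) (3 * n)%N = coef s n.
Proof. by rewrite /= dvdn_mulr // mulKn. Qed.

Lemma coef_dilate0 s n : ~~ (3 %| n)%N -> coef (dilate s) n = 0.
Proof. by move=> /= /negPf->. Qed.

Lemma sum_mult3 (F : nat -> R) n r : (r < 3)%N ->
    (forall i, ~~ (3 %| i)%N -> F i = 0) ->
  \sum_(i < (3 * n + r).+1) F i = \sum_(k < n.+1) F (3 * k)%N.
Proof.
move=> r3 F0; elim: n => [|n IHn].
  rewrite muln0 add0n big_ord_recl [RHS]big_ord1 big1 ?addr0 // => i _.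
  by apply: F0; rewrite lift0; have := ltn_ord i; lia.
rewrite [RHS]big_ord_recr -IHn /=.
have -> : (3 * n.+1 + r = (3 * n + r).+3)%N by lia.
have recr3 m :
    \sum_(i < m.+4) F i = \sum_(i < m.+1) F i + (F m.+1 + F m.+2 + F m.+3).
  by do 3!rewrite big_ord_recr /=; rewrite -!addrA.
rewrite recr3; congr (_ + _).
case: r r3 {IHn} => [|[|[|//]]] _; rewrite ?addn0.
- by rewrite (@F0 (3 * n).+1) ?(@F0 (3 * n).+2) ?addr0 ?add0r ?add0r;
    [congr F| |]; lia.
- by rewrite (@F0 (3 * n + 1).+1) ?(@F0 (3 * n + 1).+3) ?add0r ?addr0;
    [congr F| |]; lia.
- by rewrite (@F0 (3 * n + 2).+2) ?(@F0 (3 * n + 2).+3) ?addr0 ?addr0;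
    [congr F| |]; lia.
Qed.

(** A factor in q^3 passes through the extraction of a residue class mod 3. *)
Lemma trisect_dilateM r s t :
  (r < 3)%N -> trisect r (dilate s * t) = s * trisect r t.
Proof.
move=> r3; apply: seriesP => n; rewrite [LHS]coefsM coefsM.
rewrite (@sum_mult3 (fun i => coef (dilate s) i * coef t (3 * n + r - i)%N)) //.
  apply: eq_bigr => k _; rewrite coef_dilate; congr (_ * coef t _).
  by have := ltn_ord k; lia.
by move=> i i3; rewrite coef_dilate0 ?mul0r.
Qed.

(** With s = A(q^3) + q C(q^3), the exponents 2 mod 3 of s^2 are those of
    q^2 C(q^3)^2. *)
Lemma trisect2_sqr s : trisect 2 s = 0 -> trisect 2 (s ^+ 2) = trisect 1 s ^+ 2.
Proof.
move=> s2; pose a := dilate (trisect 0 s); pose b := dilate (trisect 1 s).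
have sE : s = a + b * monom 1 1.
  apply: seriesP => n; rewrite mulrC coefsD coef_monomM mul1r.
  have := divn_eq n 3; have := ltn_mod n 3.
  case: (n %% 3)%N => [|[|[|//]]] _ e.
  - rewrite e addn0 mulnC coef_dilate [X in _ + X](_ : _ = 0) ?addr0; last first.
      by case: ifP => // q0; apply: coef_dilate0; lia.
    by congr coef; lia.
  - rewrite coef_dilate0; last by lia.
    rewrite ifF; last by lia.
    by rewrite {2}e addnK mulnC coef_dilate add0r; congr coef; lia.
  - have -> : coef s n = 0.
      by rewrite e mulnC -[LHS]/(coef (trisect 2 s) (n %/ 3)%N) s2.
    by rewrite /a /b !coef_dilate0 ?if_same ?addr0 //; lia.
have trisect2_monom m : (m < 2)%N -> trisect 2 (monom 1 m : series R) = 0.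
  by move=> m2; apply: seriesP => n /=; rewrite ifF //; lia.
have -> : s ^+ 2 = a * (a + b * (monom 1 1 + monom 1 1)) + b * (b * monom 1 2).
  have -> : monom 1 2 = monom 1 1 * monom 1 1 :> series R by rewrite monomM mulr1.
  by rewrite sE; ring.
have trisect2_a : trisect 2 a = 0.
  by rewrite -[a]mulr1 -monom0 trisect_dilateM // trisect2_monom // mulr0.
have trisect2_2 : trisect 2 (monom 1 2 : series R) = 1.
  by apply: seriesP => n; rewrite coefs1 /=; case: n => // n; rewrite ifF //; lia.
rewrite trisectD !trisect_dilateM // trisectD trisect_dilateM // trisectD.
by rewrite trisect2_a trisect2_monom // trisect2_2; ring.
Qed.

End Sections.

(** Cubing is additive in characteristic 3 and fixes the coefficients. *)
Lemma F3_frobenius (s : series 'F_3) : s ^+ 3 = dilate s.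
Proof.
have c3 : 3 \in [pchar (series 'F_3)].
  rewrite inE /=; apply/eqP/seriesP => n; rewrite 2!mulrS mulr1n !coefsD coefs1.
  by case: (n == 0)%N; apply: val_inj.
have x3 (x : 'F_3) : x ^+ 3 = x by case: x => [[|[|[|]]]] //= lt3; apply: val_inj.
apply: seriesP => n.
pose p := \sum_(i < n.+1) monom (coef s i) i.
have sp : eqX n.+1 s p.
  move=> i lein; rewrite coefs_sum (bigD1 (Ordinal lein)) //= eqxx big1 ?addr0 // => k.
  by rewrite -val_eqE /= eq_sym => /negPf->.
have -> : coef (s ^+ 3) n = coef (p ^+ 3) n.
  rewrite -[s ^+ 3]/(s * (s * s)) -[p ^+ 3]/(p * (p * p)).
  by apply: (eqXM sp (eqXM sp sp)).
have -> : p ^+ 3 = \sum_(i < n.+1) monom (coef s i) i ^+ 3.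
  exact: (rmorph_sum (pFrobenius_aut c3)).
rewrite coefs_sum; under eq_bigr do rewrite monomX x3.
rewrite /=.
case: ifP => [/dvdnP[k ->] | n3]; last first.
  by rewrite big1 // => i _; rewrite ifF //; lia.
rewrite mulnK //.
have ltk : (k < (k * 3).+1)%N by lia.
rewrite (bigD1 (Ordinal ltk)) //= eqxx big1 ?addr0 // => i.
by rewrite -val_eqE /= => ik; rewrite ifF //; lia.
Qed.

(** * Trisection of the theta series *)

Lemma reindex_seq (I J : eqType) (V : zmodType) (s : seq I) (t : seq J)
    (f : J -> I) (g : I -> J) (F : I -> V) :
    uniq s -> uniq t ->
    {in t, forall y, f y \in s} -> {in s, forall x, g x \in t} ->
    {in t, cancel f g} -> {in s, cancel g f} ->
  \sum_(x <- s) F x = \sum_(y <- t) F (f y).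
Proof.
move=> us ut ft gs fK gK; rewrite -(big_map f xpredT F); apply/perm_big/uniq_perm => //.
  by rewrite map_inj_in_uniq // => x y xt yt e; rewrite -(fK x) // e fK.
move=> x; apply/idP/mapP => [xs | [y yt ->]]; last exact: ft.
by exists (g x); [apply: gs | rewrite gK].
Qed.

Lemma mod3_cases (j : int) :
  exists k, j = 3 * k \/ j = 3 * k + 1 \/ j = 3 * k + 2.
Proof.
have := divz_eq j 3; have := ltz_pmod j (isT : 0 < 3 :> int).
have := modz_ge0 j (isT : 3 != 0 :> int).
by exists (j %/ 3)%Z; lia.
Qed.

Section Lattice.
Variable R : comNzRingType.
(* Satisfied by 'F_3; it turns an antisymmetric sum into 0. *)
Hypothesis two_reg : forall x : R, x = - x -> x = 0.

Local Notation c n := (coef (phi R 1 * psi R 0) n).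

Lemma coef_phi_psi n :
  c n = \sum_(p <- lattice (sq 1) hexa n) sgn R p.1.
Proof.
rewrite coef_thetaM; [|exact: grow_sq | exact: grow_hexa].
by apply: eq_bigr => p _; rewrite expr0 mulr1.
Qed.

Lemma sgn_odd (a b : int) k : a = b + 2 * k + 1 -> sgn R a = - sgn R b.
Proof.
move=> e; rewrite /sgn -signr_odd -[in RHS]signr_odd.
have -> : odd `|a| = ~~ odd `|b| by lia.
by case: odd; rewrite ?opprK.
Qed.

(** In terms of z = (4j - 1) + 2a sqrt(-2), the lattice points (a, j) are the
    solutions of z * conj z = 8n + 1. With w = 1 + sqrt(-2), for which
    w * conj w = 3, the lines [diag] and [antidiag] modulo 3 consist of the z that
    are divisible by w and by conj w; and [reflect_lattice] is the map
    z -> conj z * w / conj w, which preserves the norm and, on [diag],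
    integrality. *)
Definition diag (p : int * int) := (3 %| 2 * p.1 - p.2 + 1)%Z.
Definition antidiag (p : int * int) := (3 %| - 2 * p.1 - p.2 + 1)%Z.
Definition reflect_lattice (p : int * int) : int * int :=
  (((4 * p.2 + p.1 - 1) %/ 3)%Z, ((2 * p.1 - p.2 + 1) %/ 3)%Z).

Local Notation L n := (lattice (sq 1) hexa n).

Lemma mem_lattice_form n p :
  (p \in L n) = (p.1 * p.1 + (2 * (p.2 * p.2) - p.2) == n%:Z).
Proof.
rewrite mem_lattice; [|exact: grow_sq | exact: grow_hexa].
by have := sqE 1 p.1; have := hexaE p.2; lia.
Qed.

Lemma reflect_latticeE a k :
  reflect_lattice (a, 2 * a + 1 - 3 * k) = (3 * a + 1 - 4 * k, k).
Proof.
rewrite /reflect_lattice /=.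
have -> : 4 * (2 * a + 1 - 3 * k) + a - 1 = (3 * a + 1 - 4 * k) * 3 by ring.
have -> : 2 * a - (2 * a + 1 - 3 * k) + 1 = k * 3 by ring.
by rewrite !mulzK.
Qed.

Lemma uniq_filter_lattice n P : uniq [seq p <- L n | P p].
Proof. exact/filter_uniq/uniq_lattice. Qed.

Lemma mem_filter_lattice n P p :
  (p \in [seq p <- L n | P p]) = P p && (p \in L n).
Proof. by rewrite mem_filter. Qed.

(** The reflection changes the parity of a, hence the sign of every term. *)
Lemma sum_diag n : \sum_(p <- [seq p <- L n | diag p]) sgn R p.1 = 0.
Proof.
have diagP p : p \in [seq p <- L n | diag p] -> exists a k,
    p = (a, 2 * a + 1 - 3 * k) /\ p \in L n.
  rewrite mem_filter_lattice => /andP[/dvdzP[k e] Lp]; exists p.1, k; split=> //.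
  by case: p e {Lp} => a j /= e; congr (_, _); lia.
have reflect_diag : {in [seq p <- L n | diag p],
    forall p, reflect_lattice p \in [seq p <- L n | diag p]}.
  move=> p /diagP[a [k [->]]].
  rewrite reflect_latticeE mem_lattice_form /= => /eqP e.
  rewrite mem_filter_lattice mem_lattice_form.
  apply/andP; split; last by rewrite -e /=; apply/eqP; ring.
  by apply/dvdzP; exists (2 * a + 1 - 3 * k); rewrite /=; ring.
have reflect_latticeK :
    {in [seq p <- L n | diag p], cancel reflect_lattice reflect_lattice}.
  move=> p /diagP[a [k [-> _]]]; rewrite reflect_latticeE.
  rewrite [X in reflect_lattice (_, X)]
    (_ : k = 2 * (3 * a + 1 - 4 * k) + 1 - 3 * (2 * a + 1 - 3 * k)); last by ring.
  by rewrite reflect_latticeE; congr (_, _); ring.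
apply: two_reg.
rewrite [LHS](@reindex_seq _ _ _ _ _ reflect_lattice reflect_lattice _
  (uniq_filter_lattice n diag) (uniq_filter_lattice n diag)) //.
rewrite -sumrN; apply: eq_big_seq => p /diagP[a [k [-> _]]].
by rewrite reflect_latticeE; apply: (@sgn_odd _ _ (a - 2 * k)); rewrite /=; ring.
Qed.

(** The symmetry a -> - a, which preserves the signs, exchanges the two lines. *)
Lemma sum_antidiag n : \sum_(p <- [seq p <- L n | antidiag p]) sgn R p.1 = 0.
Proof.
rewrite -[RHS](sum_diag n); pose neg (p : int * int) := (- p.1, p.2).
have negK : involutive neg by case=> a j; rewrite /neg /= opprK.
have neg_lattice p : (neg p \in L n) = (p \in L n).
  by rewrite !mem_lattice_form /= mulrNN.
rewrite [LHS](@reindex_seq _ _ _ _ _ neg neg _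
  (uniq_filter_lattice n antidiag) (uniq_filter_lattice n diag)) //.
- by apply: eq_bigr => p _; rewrite /sgn /= abszN.
- by move=> p; rewrite !mem_filter_lattice neg_lattice /diag /antidiag /= mulrNN.
- by move=> p; rewrite !mem_filter_lattice neg_lattice /diag /antidiag /= mulrN mulNr.
Qed.

Lemma diag_or_antidiag n p : p \in L (3 * n + 1)%N -> diag p || antidiag p.
Proof.
case: p => a j; rewrite mem_lattice_form /diag /antidiag /= => /eqP e.
have [x [ea|[ea|ea]]] := mod3_cases a; have [y [ej|[ej|ej]]] := mod3_cases j.
all: subst a j; lia.
Qed.

Lemma diag_antidiagE p : diag p && antidiag p = (3 %| p.1)%Z && (3 %| p.2 - 1)%Z.
Proof. by case: p => a j; rewrite /diag /antidiag /=; lia. Qed.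

(** For N = 3n + 1 every point lies on one of the two lines, because 3 divides the
    norm 8N + 1. The sums over the lines vanish, so the total is minus the sum over
    the points common to both. At these z is divisible by 3, and z -> conj z / (- 3)
    preserves the sign and leads to the lattice points for m, where N = 9m + 1. *)
Lemma trisect1_phi_psi :
  trisect 1 (phi R 1 * psi R 0) = - dilate (phi R 1 * psi R 0).
Proof.
apply: seriesP => n.
suff: c (3 * n + 1)%N = - (if (3 %| n)%N then c (n %/ 3)%N else 0) by [].
rewrite !coef_phi_psi.
have := sum_diag (3 * n + 1)%N; have := sum_antidiag (3 * n + 1)%N.
rewrite [X in X = _ -> _]big_filter [X in _ -> X = _ -> _]big_filter (bigID diag) /=.
move=> antidiagE diagE; rewrite (bigID diag) /= diagE add0r.
have -> : \sum_(p <- L (3 * n + 1)%N | ~~ diag p) sgn R p.1 =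
          \sum_(p <- L (3 * n + 1)%N | antidiag p && ~~ diag p) sgn R p.1.
  rewrite big_seq_cond [RHS]big_seq_cond; apply: eq_bigl => p.
  have := @diag_or_antidiag n p.
  by case: (p \in _) => // /(_ isT); case: diag; rewrite //= ?andbF // => ->.
move/eqP: antidiagE; rewrite addrC addr_eq0 => /eqP->; congr (- _).
rewrite -big_filter.
have both p : p \in [seq p <- L (3 * n + 1)%N | antidiag p && diag p] ->
    exists a j, p = (3 * a, 1 - 3 * j) /\ p \in L (3 * n + 1)%N.
  rewrite mem_filter_lattice [antidiag p && _]andbC diag_antidiagE.
  case/andP=> /andP[/dvdzP[a ea] /dvdzP[j ej]] Lp.
  exists a, (- j); split=> //.
  by case: p ea ej {Lp} => x y /= ea ej; congr (_, _); lia.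
case: ifPn => [/dvdnP[m em] | n3]; last first.
  rewrite big1_seq // => p /= /both[a [j [->]]].
  by rewrite mem_lattice_form /= => /eqP e; lia.
have -> : (n %/ 3 = m)%N by rewrite em mulnK.
pose f (p : int * int) := (3 * p.1, 1 - 3 * p.2).
pose g (p : int * int) := ((p.1 %/ 3)%Z, ((1 - p.2) %/ 3)%Z).
have lattice_f p : (f p \in L (3 * n + 1)%N) = (p \in L m).
  by rewrite !mem_lattice_form em /=; lia.
have fK : cancel f g.
  case=> a j; rewrite /f /g /=; congr (_, _); first by rewrite mulrC mulzK.
  by rewrite opprB addrCA subrr addr0 mulrC mulzK.
rewrite [LHS](@reindex_seq _ _ _ _ _ f g _
  (uniq_filter_lattice (3 * n + 1)%N (fun p => antidiag p && diag p))
  (uniq_lattice (sq 1) hexa m)).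
- apply: eq_bigr => -[a j] _; rewrite /sgn /= -signr_odd -[RHS]signr_odd.
  by congr (_ ^+ nat_of_bool _); lia.
- move=> p Lp; rewrite mem_filter_lattice lattice_f Lp andbT andbC diag_antidiagE /=.
  by apply/andP; split; apply/dvdzP; [exists p.1 | exists (- p.2)]; ring.
- by move=> p /both[a [j [-> ]]]; rewrite -[(3 * a, _)]/(f (a, j)) lattice_f fK.
- by move=> p _; apply: fK.
- by move=> p /both[a [j [-> _]]]; rewrite -[(3 * a, _)]/(f (a, j)) fK.
Qed.

End Lattice.

Section ThetaTrisection.
Variable R : comNzRingType.

(** 2j^2 - j is 1 mod 3 exactly for j = 1 - 3k, where it is 9(2k^2 - k) + 1, with the
    opposite sign (-1)^j = - (-1)^k. *)
Lemma trisect1_psi : trisect 1 (psi R 1) = - dilate (psi R 1).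
Proof.
apply: seriesP => n; rewrite coefsN -[LHS]/(coef (psi R 1) (3 * n + 1)%N).
have mem_fib (m : nat) j : (j \in fiber hexa m) = (2 * (j * j) - j == m%:Z).
  rewrite mem_filter mem_zball; have := hexaE j; have := grow_hexa j.
  by case: eqP; lia.
pose f j : int := 1 - 3 * j.
have f_fib (m : nat) j :
    (f j \in fiber hexa (3 * (3 * m) + 1)%N) = (j \in fiber hexa m).
  by rewrite !mem_fib /f; lia.
have fib1 j : j \in fiber hexa (3 * n + 1)%N -> exists k, j = f k.
  rewrite mem_fib => /eqP e; exists ((1 - j) %/ 3)%Z; rewrite /f.
  by have [k [ej|[ej|ej]]] := mod3_cases j; subst j; lia.
have uniq_fib m : uniq (fiber hexa m) by exact/filter_uniq/uniq_zball.
rewrite coef_theta; case: (boolP (3 %| n)%N) => [/dvdnP[m em] | n3]; last first.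
  rewrite coef_dilate0 // big1_seq ?oppr0 // => j /andP[_ jn].
  case: (fib1 j jn) => k ek; move: jn.
  by rewrite ek mem_fib /f => /eqP e; lia.
have fK : cancel f (fun j => ((1 - j) %/ 3)%Z).
  by move=> j; rewrite /f opprB addrCA subrr addr0 mulrC mulzK.
have {}em : n = (3 * m)%N by rewrite em mulnC.
rewrite em coef_dilate coef_theta -sumrN.
rewrite [LHS](@reindex_seq _ _ _ _ _ f _ _ (uniq_fib _) (uniq_fib m)
  _ _ (in1W fK)).
- apply: eq_bigr => j _; rewrite !expr1; rewrite /sgn -signr_odd -[in RHS]signr_odd.
  have -> : odd `|f j| = ~~ odd `|j| by rewrite /f; lia.
  by case: odd; rewrite ?opprK.
- by move=> j; rewrite f_fib.
- move=> j; rewrite -em => jn; have [k ek] := fib1 j jn.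
  by move: jn; rewrite ek em f_fib fK.
- by move=> j; rewrite -em => /fib1[k ->]; rewrite fK.
Qed.

Lemma trisect2_psi : trisect 2 (psi R 1) = 0.
Proof.
apply: seriesP => n; rewrite -[LHS]/(coef (psi R 1) (3 * n + 2)%N) coef_theta.
rewrite big1_seq // => j /andP[_]; rewrite mem_filter => /andP[/eqP e _].
have := hexaE j; rewrite e.
by have [k [->|[->|->]]] := mod3_cases j; lia.
Qed.

Lemma trisect1_phi2 : trisect 1 (phi R 2) = 0.
Proof.
apply: seriesP => n; rewrite -[LHS]/(coef (phi R 2) (3 * n + 1)%N) coef_theta.
rewrite big1_seq // => j /andP[_]; rewrite mem_filter => /andP[/eqP e _].
have := sqE 2 j; rewrite e.
by have [k [->|[->|->]]] := mod3_cases j; lia.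
Qed.

End ThetaTrisection.

(** * The generating function of B *)

Section PartitionLists.
Variables (f : nat -> nat) (M : nat).
Hypothesis f_gt0 : forall k, (0 < f k)%N.
Hypothesis f_mono : {homo f : i j / (i < j)%N}.

(** The partitions with parts among f 0, ..., f (L-1), each repeated at most M times.
    M = 1 describes distinct parts, while M >= n imposes nothing on a partition of
    n: both kinds of components of a triple are covered. *)
Fixpoint plist L : seq (seq nat) :=
  if L is L'.+1 then [seq nseq j (f L') ++ s | j <- iota 0 M.+1, s <- plist L']
  else [:: [::]].

Definition allowed L (s : seq nat) :=
  [&& is_partition s, all (fun x => x \in [seq f k | k <- iota 0 L]) s
    & all (fun x => count_mem x s <= M)%N s].

Lemma mem_img L x : (x \in [seq f k | k <- iota 0 L.+1]) =
  (x == f L) || (x \in [seq f k | k <- iota 0 L]).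
Proof. by rewrite -addn1 iotaD map_cat mem_cat mem_seq1 orbC. Qed.

Lemma lt_img L x : x \in [seq f k | k <- iota 0 L] -> (x < f L)%N.
Proof. by case/mapP => k; rewrite mem_iota add0n => /andP[_ /f_mono ltk] ->. Qed.

Lemma sorted_geq_cat j x s : all (fun y => y < x)%N s ->
  sorted geq (nseq j x ++ s) = sorted geq s.
Proof.
move=> ltx; elim: j => //= j <-; case: j => [|j] //=; last by rewrite leqnn.
by case: s ltx => //= y s /andP[/ltnW-> _].
Qed.

Lemma sorted_geq_split x s : sorted geq s -> all (fun y => y <= x)%N s ->
  exists j s', s = nseq j x ++ s' /\ all (fun y => y < x)%N s'.
Proof.
elim: s => [|y s IHs] /= sy; first by exists 0%N, [::].
case/andP; rewrite leq_eqVlt => /predU1P[exy | ltyx] lex.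
  have [j [s' [-> lts']]] := IHs (path_sorted sy) lex.
  by exists j.+1, s'; rewrite exy.
exists 0%N, (y :: s); split=> //=; rewrite ltyx /=.
have /allP le_y := order_path_min (rev_trans leq_trans) sy.
by apply/allP => z /le_y /= /leq_ltn_trans; apply.
Qed.

Lemma plistP L s : (s \in plist L) = allowed L s.
Proof.
elim: L s => [|L IHL] s.
  by rewrite /allowed; case: s => //= x s; rewrite !andbF.
apply/allpairsPdep/and3P => [[j [s' [jM]]] | [/andP[ss pos_s] im_s cnt_s]].
  rewrite IHL => /and3P[/andP[ss' pos_s'] im_s' cnt_s'] ->.
  have lt_s' : all (fun y => y < f L)%N s'.
    by apply: sub_all im_s' => y /lt_img.
  have not_s' : f L \notin s'.
    by apply/negP => /(allP lt_s'); rewrite ltnn.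
  split.
  - rewrite /is_partition sorted_geq_cat // ss' all_cat pos_s' all_nseq /=.
    by rewrite f_gt0 orbT.
  - rewrite all_cat all_nseq mem_img eqxx orbT /=.
    by apply: sub_all im_s' => y; rewrite mem_img orbC => ->.
  - rewrite all_cat all_nseq; apply/andP; split.
      rewrite count_cat count_nseq /= eqxx (count_memPn not_s') mul1n addn0.
      by move: jM; rewrite mem_iota add0n ltnS => /andP[_ ->]; rewrite orbT.
    apply/allP => y ys'; rewrite count_cat count_nseq /=.
    by rewrite [f L == y]gtn_eqF ?add0n ?(allP cnt_s') // (allP lt_s').
have le_s : all (fun y => y <= f L)%N s.
  apply: sub_all im_s => y; rewrite mem_img.
  by case/predU1P => [-> // | /lt_img/ltnW].
have [j [s' [es lt_s']]] := sorted_geq_split ss le_s.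
have not_s' : f L \notin s'.
  by apply/negP => /(allP lt_s'); rewrite ltnn.
exists j, s'; split=> //.
  rewrite mem_iota add0n ltnS; case: j es => // j es.
  have := allP cnt_s (f L); rewrite {1}es mem_head => /(_ isT).
  by rewrite es count_cat count_nseq /= eqxx mul1n; apply: leq_trans (leq_addr _ _).
rewrite IHL; apply/and3P; split.
- move: ss pos_s; rewrite /is_partition es sorted_geq_cat // all_cat.
  by move=> -> /andP[_ ->].
- apply/allP => y ys'; have := allP im_s y; rewrite es mem_cat ys' orbT mem_img.
  by move=> /(_ isT) /predU1P[ey|//]; rewrite -ey ys' in not_s'.
- apply/allP => y ys'; have := allP cnt_s y; rewrite es mem_cat ys' orbT.
  by move=> /(_ isT); apply: leq_trans; rewrite count_cat leq_addl.
Qed.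

Lemma uniq_plist L : uniq (plist L).
Proof.
elim: L => //= L IHL; apply: (@allpairs_uniq _ _ _ _ (iota 0 M.+1)) => //.
  exact: (iota_uniq 0 M.+1).
have not_f s : s \in plist L -> count_mem (f L) s = 0%N.
  rewrite plistP => /and3P[_ im_s _]; apply/count_memPn/negP => /(allP im_s)/lt_img.
  by rewrite ltnn.
move=> p q /allpairsPdep[j [s [_ ls ->]]] /allpairsPdep[k [t [_ lt ->]]] /= e.
have ejk : j = k.
  have := congr1 (count_mem (f L)) e.
  by rewrite !count_cat (not_f s ls) (not_f t lt) !count_nseq /= eqxx !mul1n !addn0.
move: e; rewrite ejk => /eqP; rewrite eqseq_cat // => /andP[_ /eqP->] //.
Qed.

Lemma plistS L :
  plist L.+1 = [seq nseq j (f L) ++ s | j <- iota 0 M.+1, s <- plist L].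
Proof. by []. Qed.

Variable R : comNzRingType.

Definition gf (l : seq (seq nat)) : series R := \sum_(s <- l) monom 1 (sumn s).

Lemma gf_plist L :
  gf (plist L) = \prod_(k < L) \sum_(j < M.+1) monom 1 (f k) ^+ j.
Proof.
elim: L => [|L IHL]; first by rewrite big_ord0 /gf big_seq1 monom0.
rewrite big_ord_recr -IHL /gf plistS big_allpairs_dep [RHS]mulrC.
rewrite -(big_mkord xpredT (fun j => monom 1 (f L) ^+ j)) /index_iota subn0.
rewrite mulr_suml; apply: eq_bigr => j _; rewrite mulr_sumr; apply: eq_bigr => s _.
by rewrite monomX expr1n monomM mulr1 sumn_cat sumn_nseq.
Qed.

End PartitionLists.

Section CountingTriples.
Variable R : comNzRingType.

(** The analogue of [gf] for the finite type of codes over which [B n] is defined. *)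
Definition code_gf n (P : pred (seq nat)) : series R :=
  \sum_(c : part_code n | P (parts c)) monom 1 (sumn (parts c)).

Lemma code_gfE n (P : pred (seq nat)) l :
    (forall s, P s -> is_partition s) -> uniq l ->
    (forall s, (sumn s <= n)%N -> (s \in l) = P s) ->
  eqX n.+1 (code_gf n P) (gf R l).
Proof.
move=> Ppart ul meml i lein; rewrite /code_gf /gf.
have -> : \sum_(c : part_code n | P (parts c)) monom 1 (sumn (parts c)) =
   \sum_(s <- [seq parts c | c <- enum (part_code n)] | P s) monom 1 (sumn s)
     :> series R.
  by rewrite big_map big_enum_cond.
rewrite !coefs_sum [LHS]big_mkcond [RHS]big_mkcond /=.
transitivity (\sum_(s <- [seq parts c | c <- enum (part_code n)] |
                      P s && (sumn s == i)) (1 : R)).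
  rewrite [RHS]big_mkcond; apply: eq_bigr => s _.
  by case: (P s) => //=; rewrite eq_sym.
transitivity (\sum_(s <- l | sumn s == i) (1 : R)); last first.
  by rewrite [LHS]big_mkcond; apply: eq_bigr => s _; rewrite /= eq_sym.
rewrite -big_filter -[RHS]big_filter; apply/perm_big/uniq_perm.
- by rewrite filter_uniq // map_inj_uniq ?enum_uniq //; apply: parts_inj.
- by rewrite filter_uniq.
move=> s; rewrite !mem_filter -andbA andbCA; case: eqP => //= si.
have les : (sumn s <= n)%N by lia.
rewrite meml //; apply/andP/idP => [[]//|Ps]; split=> //.
by have [c <-] := part_codeP (Ppart _ Ps) les; rewrite map_f // mem_enum.
Qed.

Definition distinct_odd (s : seq nat) := [&& is_partition s, uniq s & all odd s].
Definition multiples_of_4 (s : seq nat) := is_partition s && all (dvdn 4) s.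

Lemma mulr_sum_pair (A : comNzRingType) (I J : finType) (P : pred I) (Q : pred J)
    (F : I -> A) (G : J -> A) :
  (\sum_(i | P i) F i) * (\sum_(j | Q j) G j) =
  \sum_(p | P p.1 && Q p.2) F p.1 * G p.2.
Proof. by rewrite big_distrlr pair_big. Qed.

Lemma B_code_gf n :
  (B n)%:R = coef (code_gf n distinct_odd * code_gf n distinct_odd *
                   code_gf n multiples_of_4) n :> R.
Proof.
rewrite /code_gf !mulr_sum_pair coefs_sum.
rewrite /B -sum1_card natr_sum.
rewrite [LHS]big_mkcond [RHS]big_mkcond; apply: eq_bigr => -[[c d] e] _.
rewrite inE /partition_triple !monomM !mulr1 /= eq_sym.
rewrite -/(distinct_odd (parts c)) -/(distinct_odd (parts d)).
rewrite -/(multiples_of_4 (parts e)).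
by do 3!case: (_ (parts _)).
Qed.

Lemma mem_sumn (s : seq nat) x : x \in s -> (x <= sumn s)%N.
Proof.
elim: s => //= y s IHs; rewrite inE => /predU1P[-> | /IHs]; first exact: leq_addr.
by move=> /leq_trans; apply; apply: leq_addl.
Qed.

Lemma count_sumn (s : seq nat) x : (0 < x)%N -> (count_mem x s <= sumn s)%N.
Proof. by move=> x0; elim: s => //= y s IHs; case: eqP => [->|_] /=; lia. Qed.

Definition Bseries : series R := Series (fun n => (B n)%:R).

(** Euler's product for B, with the denominator (q^4; q^4) on the left. *)
Lemma Bseries_qprod :
  Bseries * qprod R 1 4 4 = qprod R 0 1 2 ^+ 2.
Proof.
apply: eqXP => N.
pose fo k := k.*2.+1; pose f4 k := (4 * k.+1)%N.
have fo0 k : (0 < fo k)%N by [].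
have f40 k : (0 < f4 k)%N by [].
have fom : {homo fo : i j / (i < j)%N} by move=> i j; rewrite /fo; lia.
have f4m : {homo f4 : i j / (i < j)%N} by move=> i j; rewrite /f4; lia.
pose go := gf R (plist fo 1 N); pose g4 := gf R (plist f4 N N).
have Bg : eqX N Bseries (go * go * g4).
  move=> i ltiN; rewrite [LHS]B_code_gf.
  have eo : eqX i.+1 (code_gf i distinct_odd) go.
    apply: code_gfE => [s /and3P[] // | | s les]; first exact: uniq_plist.
    rewrite plistP // /allowed /distinct_odd; case: is_partition => //=.
    rewrite andbC; congr (_ && _).
      apply/allP/idP => [cnt | us x xs]; last by rewrite count_uniq_mem ?leq_b1.
      apply/count_mem_uniq => x; have := cnt x; rewrite -has_pred1 has_count.
      by case: (count _ _) => // n /(_ isT); case: n.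
    apply: eq_in_all => x xs; apply/mapP/idP => [[k _ ->] | ox].
      by rewrite /fo /= odd_double.
    exists x./2; rewrite ?mem_iota /fo; last by lia.
    by have := mem_sumn xs; lia.
  have e4 : eqX i.+1 (code_gf i multiples_of_4) g4.
    apply: code_gfE => [s /andP[] // | | s les]; first exact: uniq_plist.
    rewrite plistP // /allowed /multiples_of_4.
    case: (boolP (is_partition s)) => //= /andP[_ pos].
    (* A part of a partition of at most N is repeated at most N times. *)
    rewrite [X in _ && X](_ : _ = true) ?andbT; last first.
      by apply/allP => x /(allP pos) /(count_sumn s) /=; lia.
    apply: eq_in_all => x xs; apply/mapP/idP => [[k _ ->] | /dvdnP[k ek]].
      exact: dvdn_mulr.
    have x0 : (0 < x)%N := allP pos x xs; have lex := mem_sumn xs.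
    by exists k.-1; rewrite ?mem_iota /f4; lia.
  by apply: (eqXM (eqXM eo eo) e4).
have goE : eqX N go (qprod R 0 1 2).
  apply/eqX_sym/(eqX_trans (iprodP (prod_cvg_qprod R 0 _ _) (leqnn N))) => //.
  rewrite /go gf_plist.
  suff -> : \prod_(k < N) (1 + monom ((-1) ^+ 0) (1 + 2 * k)) =
     \prod_(k < N) \sum_(j < 2) monom 1 (fo k) ^+ j :> series R by [].
  apply: eq_bigr => k _; rewrite big_ord_recr big_ord1 expr0 expr1.
  by congr (1 + monom _ _); rewrite /fo; lia.
have g4E : eqX N (g4 * qprod R 1 4 4) 1.
  have E4 := iprodP (@prod_cvg_qprod R 1 4 4 isT isT) (leqnn N).
  apply: (eqX_trans (eqXM (@eqX_refl _ N g4) E4)).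
  rewrite /g4 gf_plist -big_split.
  apply: eqX_prod1 => k /=.
  have -> : (4 + 4 * k)%N = f4 k by rewrite /f4; lia.
  (* A geometric sum: the factor is 1 - q^(4(k+1)(N+1)). *)
  rewrite expr1 monomN mulrC -opprB mulNr -subrX1 opprB monomX expr1n.
  by apply/eqX1B/(eqXW _ (@eqX_monom _ _ _)); rewrite /f4; nia.
apply: eqX_trans (eqXMr _ Bg) _; rewrite -mulrA.
rewrite -[X in eqX _ _ X]mulr1 expr2; apply: eqXM g4E.
exact: eqXM.
Qed.

End CountingTriples.

(** In product form, F psi(-q)^2 = phi(-q^2); then [phi_psi] applies. *)
Lemma Bseries_theta (R : comNzRingType) :
  Bseries R * psi R 1 ^+ 3 = phi R 1 * psi R 0.
Proof.
have phi2E : Bseries R * psi R 1 ^+ 2 = phi R 2.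
  rewrite psi_qprod phi_qprod // -[(2 * 2)%N]/4%N.
  rewrite -(@qprod_conj R 1 2 isT isT : _ = qprod R 1 2 4).
  transitivity ((Bseries R * qprod R 1 4 4) * qprod R 1 1 2 ^+ 2 * qprod R 1 4 4).
    by ring.
  by rewrite Bseries_qprod; ring.
by rewrite phi_psi -phi2E; ring.
Qed.

(** * The congruence *)

(** The exponents 27n + 16 are reached by the residues 1, 2, 1 modulo 3 in turn. In
    the first two steps the multiplier of F, then of F1, is psi(-q)^3, a series in
    q^3; in the last step F2 is phi(-q^2) times a series in q^3, and 2a^2 is never
    1 mod 3. *)
Lemma trisect_Bseries :
  trisect 1 (trisect 2 (trisect 1 (Bseries 'F_3))) = 0.
Proof.
pose F := Bseries 'F_3; pose P := psi 'F_3 1; pose T := phi 'F_3 1 * psi 'F_3 0.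
have P0 : coef P 0 = 1.
  by rewrite /P psi_qprod coefsM big_ord1 !coef_qprod0 // mulr1.
have two_reg (x : 'F_3) : x = - x -> x = 0.
  by case: x => [[|[|[|]]]] //= lt3 /(congr1 val) //= ?; apply: val_inj.
have F1 : P * trisect 1 F = - dilate T.
  rewrite -trisect1_phi_psi // /T -Bseries_theta F3_frobenius.
  by rewrite [Bseries _ * _]mulrC trisect_dilateM.
have F2 : trisect 2 (trisect 1 F) = - (dilate P * (dilate P * phi 'F_3 2)).
  apply: (series_cancel P0); rewrite mulrC -trisect_dilateM // -F3_frobenius.
  have -> : P ^+ 3 * trisect 1 F = - (dilate T * P ^+ 2).
    by rewrite -mulNr -F1; ring.
  rewrite trisectN trisect_dilateM // trisect2_sqr ?trisect2_psi //.
  by rewrite trisect1_psi /T phi_psi /P -F3_frobenius; ring.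
by rewrite -/F F2 trisectN !trisect_dilateM // trisect1_phi2 !mulr0 oppr0.
Qed.

Local Close Scope ring_scope.

Theorem theorem1p2 (n : nat) : B (27 * n + 16) = 0 %[mod 3].
Proof.
have /eqP : ((B (27 * n + 16)%N)%:R = 0 :> 'F_3)%R.
  have -> : 27 * n + 16 = 3 * (3 * (3 * n + 1) + 2) + 1 by lia.
  exact: (congr1 (fun s => coef s n) trisect_Bseries).
by rewrite -(@dvdn_pcharf _ 3) ?pchar_Fp // => /eqP.
Qed.
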